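(* Let $a,b,c$ satisfy one of: (a) $a,b,c$ are real, $a+c>0$ and $b\ge a$; or (b) $c$ is real and $a,b$ are complex conjugates with $\operatorname{Im}(a)\neq 0$. For $s\in\mathbb{R}$ and $n\ge0$ let $p_n(x;s)=p_n(x\,|\,c-s,\,a+s,\,b+s)$. If $s<t$ and $x\in E_s$, then for all $n=0,1,2,\dots$ $$\int_{\mathbb{R}} p_n(y;t)\,\mathfrak p_{s,t}(x,dy)=p_n(x;s).$$
   Context: Continuous dual Hahn polynomials. For $\alpha$ real and $\beta,\gamma$ either both real or a complex conjugate pair, put $A_n=(n+\alpha+\beta)(n+\alpha+\gamma)$ and $C_n=n(n-1+\beta+\gamma)$, $n\ge 0$. The monic polynomials $p_n(x|\alpha,\beta,\gamma)$ are defined by $p_{-1}=0$, $p_0=1$ and $$x\,p_n(x|\alpha,\beta,\gamma)=p_{n+1}(x|\alpha,\beta,\gamma)+(A_n+C_n-\alpha^2)\,p_n(x|\alpha,\beta,\gamma)+A_{n-1}C_n\,p_{n-1}(x|\alpha,\beta,\gamma),\quad n\ge 0.$$ When $\prod_{j=1}^n A_{j-1}C_j\ge 0$ for all $n\ge1$, $\nu(dx|\alpha,\beta,\gamma)$ denotes the (unique) probability measure on $\mathbb{R}$ with all moments such that $\int p_n(x|\alpha,\beta,\gamma)p_m(x|\alpha,\beta,\gamma)\,\nu(dx|\alpha,\beta,\gamma)=\delta_{m,n}\prod_{j=1}^nA_{j-1}C_j$ for all $m,n\ge 0$. Sets $E_s$. For $s\in\mathbb{R}$, $E_s=[-(c-s)^2,\infty)$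 if $s\le c$, and $E_s=\{-(c-s+N)^2: N=0,1,\dots,\ N<s-c\}\cup[0,\infty)$ if $s>c$. Transition kernels. For $-\infty<s<t<\infty$ and $x\in E_s$, $$\mathfrak p_{s,t}(x,dy)=\begin{cases}\nu(dy|c-t,\;t-s-i\sqrt{x},\;t-s+i\sqrt{x}), & x\ge 0,\\ \nu(dy|c-t,\;t-s-\sqrt{-x},\;t-s+\sqrt{-x}), & x<0.\end{cases}$$ (These orthogonality measures exist for $x\in E_s$.) *)

(* Defs.v *)
From HB Require Import structures.
From mathcomp Require Import all_boot all_order all_algebra.
From mathcomp Require Import all_classical all_reals all_analysis.
From mathcomp Require Import complex.

Set Implicit Arguments.
Unset Strict Implicit.
Unset Printing Implicit Defensive.

Import Order.TTheory GRing.Theory Num.Theory.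

Local Open Scope ring_scope.
Local Open Scope complex_scope.
Local Open Scope classical_set_scope.

Definition real_or_conj (R : realType) (z w : R[i]) : Prop :=
  (complex.Im z = 0 /\ complex.Im w = 0) \/ w = z^*.

Definition cdhAC (R : realType) (alpha : R) (beta gamma : R[i]) (n : nat) : R[i] :=
  (n%:R + alpha%:C + beta) * (n%:R + alpha%:C + gamma).

Definition cdhCC (R : realType) (beta gamma : R[i]) (n : nat) : R[i] :=
  n%:R * (n%:R - 1 + beta + gamma).

(* The coefficients are only meant for [real_or_conj beta gamma]; taking real
   parts then loses nothing, see [cdhA_real] and [cdhC_real]. *)
Definition cdhA (R : realType) (alpha : R) (beta gamma : R[i]) (n : nat) : R :=
  complex.Re (cdhAC alpha beta gamma n).

Definition cdhC (R : realType) (beta gamma : R[i]) (n : nat) : R :=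
  complex.Re (cdhCC beta gamma n).

Lemma natr_complex (R : realType) (n : nat) : (n%:R : R[i]) = n%:R +i* 0.
Proof. by rewrite -(rmorph_nat (real_complex R)). Qed.

Lemma cdhA_real (R : realType) (alpha : R) (beta gamma : R[i]) (n : nat) :
  real_or_conj beta gamma ->
  (cdhA alpha beta gamma n)%:C = cdhAC alpha beta gamma n.
Proof.
rewrite /cdhA /cdhAC natr_complex.
case: beta gamma => [b b'] [g g'] [[/= -> ->]|[-> ->]] /=;
  apply/eqP; rewrite eq_complex /= eqxx /= !add0r.
  by rewrite mulr0 mul0r addr0.
by rewrite mulrN mulrC addNr.
Qed.

Lemma cdhC_real (R : realType) (beta gamma : R[i]) (n : nat) :
  real_or_conj beta gamma ->
  (cdhC beta gamma n)%:C = cdhCC beta gamma n.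
Proof.
rewrite /cdhC /cdhCC natr_complex.
case: beta gamma => [b b'] [g g'] [[/= -> ->]|[-> ->]] /=;
  by apply/eqP; rewrite eq_complex /= eqxx /= ?oppr0 ?add0r ?addr0 ?subrr
    ?mulr0 ?mul0r ?addr0.
Qed.

(* The coefficient of p_{-1} = 0 is immaterial, so the recurrence for
   [n = 0] has no last term. *)
Fixpoint cdh (R : realType) (alpha : R) (beta gamma : R[i]) (n : nat) : {poly R} :=
  if n is m.+1 then
    ('X - (cdhA alpha beta gamma m + cdhC beta gamma m - alpha ^+ 2)%:P)
      * cdh alpha beta gamma m
    - (if m is k.+1 then
         (cdhA alpha beta gamma k * cdhC beta gamma m) *: cdh alpha beta gamma k
       else 0)
  else 1.

(* [is_cdh_measure alpha beta gamma mu] says that [mu] is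
   nu(dx | alpha, beta, gamma).  The condition prod_(j <= n) A_(j-1) C_j >= 0
   for the existence of nu is implied by the case [m = n]. *)
Definition is_cdh_measure (R : realType) (alpha : R) (beta gamma : R[i])
    (mu : probability (measurableTypeR R) R) : Prop :=
  (forall k : nat, mu.-integrable setT (fun x : R => (x ^+ k)%:E)) /\
  (forall m n : nat,
     (\int[mu]_x ((cdh alpha beta gamma n).[x] * (cdh alpha beta gamma m).[x])%:E
      = ((m == n)%:R *
         \prod_(1 <= j < n.+1) (cdhA alpha beta gamma j.-1 * cdhC beta gamma j))%:E)%E).

Definition cdhE (R : realType) (c s : R) : set R :=
  if s <= c then [set x | - (c - s) ^+ 2 <= x]
  else [set x | exists2 N : nat, N%:R < s - c & x = - (c - s + N%:R) ^+ 2]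
       `|` [set x | 0 <= x].

(* [is_cdh_kernel c s t x mu] says that [mu] is the transition kernel
   p_{s,t}(x, dy); it is meant for [s < t] and [x] in [cdhE c s]. *)
Definition is_cdh_kernel (R : realType) (c s t x : R)
    (mu : probability (measurableTypeR R) R) : Prop :=
  if 0 <= x then
    is_cdh_measure (c - t) ((t - s) -i* Num.sqrt x) ((t - s) +i* Num.sqrt x) mu
  else
    is_cdh_measure (c - t) (t - s - Num.sqrt (- x))%:C (t - s + Num.sqrt (- x))%:C mu.

Definition cdh_at (R : realType) (a b : R[i]) (c : R) (n : nat) (s : R) : {poly R} :=
  cdh (c - s) (a + s%:C) (b + s%:C) n.

Definition cdh_params (R : realType) (a b : R[i]) (c : R) : Prop :=
  [/\ complex.Im a = 0, complex.Im b = 0, 0 < complex.Re a + c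
    & complex.Re a <= complex.Re b]
  \/ (b = a^* /\ complex.Im a != 0).

(* Main.v *)
From HB Require Import structures.
Require Import Defs.
From mathcomp Require Import all_boot all_order all_algebra.
From mathcomp Require Import all_classical all_reals all_analysis.
From mathcomp Require Import complex.
From mathcomp Require Import ring.
Import Order.TTheory GRing.Theory Num.Theory.
Local Open Scope ring_scope.
Local Open Scope complex_scope.
Local Open Scope classical_set_scope.

(** The polynomials have an explicit form.  In the basis
    phi_k(y) = prod_(j < k) (y + (alpha + j)^2) of quadratic factors,
    p_n(y | alpha, beta, gamma)
      = sum_k (-1)^(n-k) C(n, k) (prod_(k <= j < n) A_j) phi_k(y),
    which is the terminating 3F2 representation with its denominators cleared
    ([cdh_expansion]).

    Let L be a linear functional with L(1) = 1 that kills every p_n with n > 0,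
    as integration against nu does.  Applying L to the expansion and using
    sum_k (-1)^(n-k) C(n, k) = 0 gives, by induction, the moments
    L(phi_k) = prod_(j < k) A_j ([cdh_functional_basis]).

    For the kernel p_{s,t}(x, dy) one has alpha = c - t and
    A_j = (c - s + j)^2 + x, the square root of x having cancelled in the
    product.  So the kernel sends phi_k built on c - t to the value at x of phi_k
    built on c - s.  On the other hand, the coefficients A_n of the polynomials
    p_n( ; t) are (n + c + a)(n + c + b), in which t has disappeared.  Hence
    p_n( ; t) and p_n( ; s) have the same coefficients in their respective
    bases, and the kernel maps one to the other. *)

(** * Expansion in the quadratic-factor basis *)

Definition cdh_basis {R : comNzRingType} (alpha : R) (k : nat) : {poly R} :=
  \prod_(0 <= j < k) ('X + ((alpha + j%:R) ^+ 2)%:P).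

(** The sign exponent is [n + k], of the same parity as [n - k]. *)
Definition cdh_coef {R : comNzRingType} (A : nat -> R) (n k : nat) : R :=
  (-1) ^+ (n + k) * 'C(n, k)%:R * \prod_(k <= j < n) A j.

Lemma cdh_coef_small {R : comNzRingType} (A : nat -> R) (n k : nat) :
  (n < k)%N -> cdh_coef A n k = 0.
Proof. by move=> nk; rewrite /cdh_coef bin_small// mulr0 mul0r. Qed.

Lemma cdh_coef_diag {R : comNzRingType} (A : nat -> R) (n : nat) :
  cdh_coef A n n = 1.
Proof.
by rewrite /cdh_coef binn big_geq// !mulr1 -signr_odd addnn odd_double.
Qed.

Lemma cdh_basis_mulX {R : comNzRingType} (alpha : R) (k : nat) :
  'X * cdh_basis alpha k =
  cdh_basis alpha k.+1 - ((alpha + k%:R) ^+ 2) *: cdh_basis alpha k.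
Proof.
rewrite [cdh_basis alpha k.+1]big_nat_recr//= -/(cdh_basis alpha k).
by rewrite -mul_polyC; ring.
Qed.

Lemma cdh_coef_sum_widen {R : comNzRingType} (A : nat -> R)
    (f : nat -> {poly R}) (n N : nat) : (n < N)%N ->
  \sum_(0 <= k < n.+1) cdh_coef A n k *: f k =
  \sum_(0 <= k < N) cdh_coef A n k *: f k.
Proof.
move=> nN; rewrite [RHS](big_cat_nat (leq0n n.+1) nN)//= [X in _ + X]big_nat_cond.
rewrite [X in _ + X]big1 ?addr0// => i; rewrite andbT => /andP[ni _].
by rewrite cdh_coef_small// scale0r.
Qed.

Section coefficient_recurrence.
Context {R : comNzRingType}.
Variables (alpha sigma pi : R).

Let A (n : nat) : R := (n%:R + alpha) ^+ 2 + (n%:R + alpha) * sigma + pi.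
Let C (n : nat) : R := n%:R * (n%:R - 1 + sigma).

Lemma cdh_coef_rec0 (n : nat) :
  cdh_coef A n.+1 0 =
  - (A n + C n) * cdh_coef A n 0 - A n.-1 * C n * cdh_coef A n.-1 0.
Proof.
case: n => [|n].
  by rewrite /cdh_coef /C !addn0 !bin0 big_nat1 big_geq//=; ring.
rewrite /cdh_coef !addn0 !bin0 !big_nat_recr//= !exprS; ring.
Qed.

(** For k < n every term has the factor (-1)^(n+k) prod_(k < j < n) A_j, and
    what remains is an identity between binomial coefficients.  It holds
    because A_n - A_k factors as
    (n - k) (n + k + 2 alpha + sigma) and (k + 1) C(n, k + 1) = (n - k) C(n, k). *)
Lemma cdh_coef_recS (n k : nat) :
  cdh_coef A n.+1 k.+1 =
  cdh_coef A n k
  - ((alpha + k.+1%:R) ^+ 2 - alpha ^+ 2 + A n + C n) * cdh_coef A n k.+1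
  - A n.-1 * C n * cdh_coef A n.-1 k.+1.
Proof.
have [nk|kn|<-] := ltngtP n k.
- rewrite !cdh_coef_small ?mulr0 ?subr0//.
  + by rewrite ltnS (leq_trans (leq_pred _))// ltnW.
  + by rewrite ltnS ltnW.
- case: n kn => // m kn; rewrite succnK.
  set Q := \prod_(k.+1 <= j < m.+1) A j.
  (* for k = m the binomial factor vanishes, so the missing factor is harmless *)
  have lastE : 'C(m, k.+1)%:R * (\prod_(k.+1 <= j < m) A j * A m) =
               'C(m, k.+1)%:R * Q.
    have [km|mk] := ltnP k m; first by rewrite /Q big_nat_recr.
    by rewrite bin_small ?ltnS// !mul0r.
  have diagE : m.+1%:R * 'C(m, k)%:R = k.+1%:R * 'C(m.+1, k.+1)%:R :> R.
    by rewrite -!natrM mul_bin_diag.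
  have leftE : k.+1%:R * 'C(m.+1, k.+1)%:R =
               (m.+1%:R - k%:R) * 'C(m.+1, k)%:R :> R.
    by rewrite -natrB ?(ltnW kn)// -!natrM mul_bin_left.
  have vE : 'C(m, k.+1)%:R = 'C(m.+1, k.+1)%:R - 'C(m, k)%:R :> R.
    by rewrite binS natrD addrK.
  have key : ('C(m.+1, k.+1)%:R + 'C(m.+1, k)%:R) * A m.+1 =
     'C(m.+1, k)%:R * A k
     + ((alpha + k.+1%:R) ^+ 2 - alpha ^+ 2 + A m.+1 + C m.+1)
         * 'C(m.+1, k.+1)%:R
     - C m.+1 * 'C(m, k.+1)%:R :> R.
    (* the difference of the two sides, as a combination of the two binomial
       identities *)
    apply: subr0_eq; transitivity
      ((m.+1%:R + k%:R + alpha *+ 2 + sigma)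
         * ((m.+1%:R - k%:R) * 'C(m.+1, k)%:R - k.+1%:R * 'C(m.+1, k.+1)%:R)
       - (m.+1%:R - 1 + sigma)
         * (m.+1%:R * 'C(m, k)%:R - k.+1%:R * 'C(m.+1, k.+1)%:R)).
      by rewrite vE /A /C; ring.
    by rewrite diagE leftE !subrr !mulr0 subrr.
  rewrite /cdh_coef [in LHS]big_nat_recr//= -/Q big_ltn// -/Q binS natrD.
  set D := \prod_(k.+1 <= j < m) A j in lastE *.
  have -> : A m * C m.+1 * ((-1) ^+ (m + k.+1) * 'C(m, k.+1)%:R * D) =
      C m.+1 * (-1) ^+ (m + k.+1) * ('C(m, k.+1)%:R * (D * A m)) by ring.
  rewrite lastE !addnS !addSn !exprS.
  transitivity (- (-1) ^+ (m + k) * Q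
      * (('C(m.+1, k.+1)%:R + 'C(m.+1, k)%:R) * A m.+1)); first by ring.
  by rewrite key; ring.
- rewrite !cdh_coef_diag !cdh_coef_small ?mulr0 ?subr0//.
  by rewrite ltnS leq_pred.
Qed.

End coefficient_recurrence.

Section expansion.
Context {R : realType}.
Variables (alpha : R) (beta gamma : R[i]).

Let sigma := complex.Re beta + complex.Re gamma.
Let pi := complex.Re (beta * gamma).

(** Real parts preserve the shape of the coefficients: A_n and C_n depend only
    on alpha and the real numbers sigma and pi, which makes the expansion an
    identity over a commutative ring. *)
Lemma cdhA_quadratic (n : nat) :
  cdhA alpha beta gamma n =
  (n%:R + alpha) ^+ 2 + (n%:R + alpha) * sigma + pi.
Proof.
rewrite /cdhA /cdhAC /sigma /pi natr_complex.
by case: beta gamma => [b b'] [g g'] /=; ring.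
Qed.

Lemma cdhC_linear (n : nat) :
  cdhC beta gamma n = n%:R * (n%:R - 1 + sigma).
Proof.
rewrite /cdhC /cdhCC /sigma natr_complex.
by case: beta gamma => [b b'] [g g'] /=; ring.
Qed.

(** Since C_0 = 0, the truncated predecessor makes the recurrence uniform in
    [n]. *)
Lemma cdhS (n : nat) :
  cdh alpha beta gamma n.+1 =
  ('X - (cdhA alpha beta gamma n + cdhC beta gamma n - alpha ^+ 2)%:P)
    * cdh alpha beta gamma n
  - (cdhA alpha beta gamma n.-1 * cdhC beta gamma n)
      *: cdh alpha beta gamma n.-1.
Proof.
case: n => [|//].
have C0 : cdhC beta gamma 0 = 0 by rewrite cdhC_linear mul0r.
by rewrite /= C0 mulr0 scale0r.
Qed.

(** Multiplication by y sends phi_k to phi_(k+1) - (alpha + k)^2 phi_k, so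
    comparing coefficients of the phi_k turns the three-term recurrence into
    [cdh_coef_rec0] and [cdh_coef_recS]. *)
Lemma cdh_expansion (n : nat) :
  cdh alpha beta gamma n =
  \sum_(0 <= k < n.+1)
    cdh_coef (cdhA alpha beta gamma) n k *: cdh_basis alpha k.
Proof.
have AE : cdhA alpha beta gamma =
    fun n => (n%:R + alpha) ^+ 2 + (n%:R + alpha) * sigma + pi.
  by apply/funext => m; exact: cdhA_quadratic.
have [m] := ubnP n; elim: m n => // m IH [|n] nm.
  by rewrite big_nat1 cdh_coef_diag scale1r /cdh_basis big_geq.
rewrite cdhS (IH n)// (IH n.-1); last by rewrite (leq_ltn_trans (leq_pred n)).
set A := cdhA _ _ _; set phi := cdh_basis alpha.
rewrite (@cdh_coef_sum_widen _ _ _ n.-1 n.+2) ?ltnS ?(leq_trans (leq_pred n))//.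
have -> : ('X - (A n + cdhC beta gamma n - alpha ^+ 2)%:P) *
      (\sum_(0 <= k < n.+1) cdh_coef A n k *: phi k) =
    \sum_(0 <= k < n.+1) cdh_coef A n k *: phi k.+1
    - \sum_(0 <= k < n.+2) cdh_coef A n k *:
        (((alpha + k%:R) ^+ 2 - alpha ^+ 2 + A n + cdhC beta gamma n) *: phi k).
  rewrite -(@cdh_coef_sum_widen _ _ _ n n.+2)// mulr_sumr -sumrB.
  apply: eq_bigr => k _.
  rewrite -scalerAr mulrBl cdh_basis_mulX mul_polyC -scalerBr; congr (_ *: _).
  by rewrite -/phi -addrA -opprD -scalerDl; congr (_ - _ *: _); ring.
rewrite [X in _ - X - _]big_nat_recl// [X in _ - _ *: X]big_nat_recl//.
rewrite [RHS]big_nat_recl//.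
have -> : cdh_coef A n.+1 0 = - (A n + cdhC beta gamma n) * cdh_coef A n 0
    - A n.-1 * cdhC beta gamma n * cdh_coef A n.-1 0.
  by rewrite /A AE cdhC_linear cdh_coef_rec0.
have -> : \sum_(0 <= k < n.+1) cdh_coef A n.+1 k.+1 *: phi k.+1 =
   \sum_(0 <= k < n.+1) cdh_coef A n k *: phi k.+1
   - \sum_(0 <= k < n.+1) cdh_coef A n k.+1 *:
    (((alpha + k.+1%:R) ^+ 2 - alpha ^+ 2 + A n + cdhC beta gamma n)
       *: phi k.+1)
   - (A n.-1 * cdhC beta gamma n) *:
       \sum_(0 <= k < n.+1) cdh_coef A n.-1 k.+1 *: phi k.+1.
  rewrite scaler_sumr -!sumrB; apply: eq_bigr => k _.
  rewrite !scalerA -!scalerBl; congr (_ *: _).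
  by rewrite /A AE cdhC_linear cdh_coef_recS; ring.
rewrite -!mul_polyC; ring.
Qed.

End expansion.

(** * Functionals orthogonal to the polynomials of positive degree *)

Lemma cdh_coef_mul_prod {R : comNzRingType} (A : nat -> R) (n k : nat) :
  (k <= n)%N ->
  cdh_coef A n k * \prod_(0 <= j < k) A j =
  (-1) ^+ (n + k) * 'C(n, k)%:R * \prod_(0 <= j < n) A j.
Proof.
move=> kn; rewrite /cdh_coef [in RHS](big_cat_nat (leq0n k) kn)/=.
by rewrite -!mulrA; congr (_ * (_ * _)); rewrite mulrC.
Qed.

Lemma sum_sign_bin {R : comNzRingType} (n : nat) :
  \sum_(0 <= k < n.+2) (-1) ^+ (n.+1 + k) * 'C(n.+1, k)%:R = 0 :> R.
Proof.
transitivity ((-1) ^+ n.+1 * (-1 + 1) ^+ n.+1 : R).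
  rewrite exprD1n big_mkord mulr_sumr; apply: eq_bigr => k _.
  by rewrite exprD -mulrA mulr_natr.
by rewrite addNr expr0n mulr0.
Qed.

(** A functional killing all p_n with n > 0 is determined by its value at 1,
    and the expansion of p_n expresses L(phi_n) through L(phi_k), k < n. *)
Lemma cdh_functional_basis {R : realType} (alpha : R) (beta gamma : R[i])
    (L : {scalar {poly R}}) :
  L 1 = 1 -> (forall n, L (cdh alpha beta gamma n.+1) = 0) ->
  forall k, L (cdh_basis alpha k) = \prod_(0 <= j < k) cdhA alpha beta gamma j.
Proof.
move=> L1 L0 k; have [m] := ubnP k; elim: m k => // m IH [|k] km.
  by rewrite /cdh_basis !big_geq.
have := L0 k; rewrite cdh_expansion linear_sum big_nat_recr//=.
rewrite cdh_coef_diag scale1r => /(canRL (addKr _)) ->; rewrite addr0.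
set A := cdhA _ _ _.
have := @sum_sign_bin R k; rewrite big_nat_recr//= binn => /(canRL (addrK _)).
rewrite sub0r mulr1 -signr_odd addnn odd_double expr0 => sumE.
transitivity (- (-1 * \prod_(0 <= j < k.+1) A j)); last by rewrite mulN1r opprK.
rewrite -sumE mulr_suml; congr (- _).
apply: eq_big_nat => j /andP[_ jk].
by rewrite linearZ/= IH ?(leq_trans jk)// cdh_coef_mul_prod ?(ltnW jk).
Qed.

Section polynomial_integral.
Context {R : realType} (mu : probability (measurableTypeR R) R).
Hypothesis moments :
  forall k : nat, mu.-integrable setT (fun x : R => (x ^+ k)%:E).

Lemma integrable_horner (p : {poly R}) :
  mu.-integrable setT (EFin \o (fun x : R => p.[x])).
Proof.
have -> : EFin \o (fun x : R => p.[x]) =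
    (fun x : R => \sum_(i <- index_enum 'I_(size p)) (p`_i)%:E * (x ^+ i)%:E)%E.
  by apply/funext => x /=; rewrite horner_coef -sumEFin.
by apply: integrable_sum => // i _; exact: integrableZl.
Qed.

Lemma integral_horner (p : {poly R}) :
  (\int[mu]_x (p.[x])%:E = (\int[mu]_x p.[x])%:E)%E.
Proof. by rewrite /Rintegral fineK// integrable_fin_num// integrable_horner. Qed.

Lemma Rintegral_horner_scalar : scalar (fun p : {poly R} => \int[mu]_x p.[x]).
Proof.
move=> a p q /=; under eq_Rintegral do rewrite hornerD hornerZ.
rewrite RintegralD//= ?RintegralZl//; try exact: integrable_horner.
by rewrite -[X in integrable _ _ X]/(fun x => a%:E * (p.[x])%:E)%E;
  apply: integrableZl => //; exact: integrable_horner.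
Qed.

Definition Rintegral_horner : {scalar {poly R}} :=
  HB.pack (fun p : {poly R} => \int[mu]_x p.[x])
    (GRing.isLinear.Build _ _ _ _ _ Rintegral_horner_scalar).

End polynomial_integral.

(** * The projection formula *)

Lemma cdh_measure_basis {R : realType} (alpha : R) (beta gamma : R[i])
    (mu : probability (measurableTypeR R) R) :
  is_cdh_measure alpha beta gamma mu -> forall k,
  \int[mu]_y (cdh_basis alpha k).[y] =
  \prod_(0 <= j < k) cdhA alpha beta gamma j.
Proof.
move=> [moments orth].
apply: (@cdh_functional_basis _ _ _ _ (Rintegral_horner mu moments)) => [|n].
  rewrite -[LHS]/(\int[mu]_x (1 : {poly R}).[x]).
  under eq_Rintegral do rewrite hornerC.
  rewrite Rintegral_cst// mul1r.
  exact: (congr1 fine (probability_setT mu)).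
rewrite -[LHS]/(\int[mu]_x (cdh alpha beta gamma n.+1).[x]).
apply: EFin_inj; rewrite -integral_horner//.
have := orth 0%N n.+1; rewrite mul0r => <-.
by apply: eq_integral => y _; rewrite /= hornerC mulr1.
Qed.

(** In both branches of the kernel beta - (t - s) and gamma - (t - s) are the two
    square roots of -x.  They are opposite and have product x, hence
    A_j = (c - s + j)^2 + x, the j-th factor of phi_k built on c - s. *)
Lemma cdh_kernel_basis {R : realType} (c s t x : R)
    (mu : probability (measurableTypeR R) R) :
  is_cdh_kernel c s t x mu -> forall k,
  \int[mu]_y (cdh_basis (c - t) k).[y] = (cdh_basis (c - s) k).[x].
Proof.
move=> ker k; rewrite /cdh_basis horner_prod.
under [RHS]eq_bigr do rewrite hornerD hornerX hornerC.
move: ker; rewrite /is_cdh_kernel.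
case: ifPn => [x0|]; last rewrite -ltNge => x0.
  move=> /cdh_measure_basis ->; apply: eq_bigr => j _.
  by rewrite cdhA_quadratic /=; ring: (sqr_sqrtr x0).
have Nx0 : 0 <= - x by rewrite oppr_ge0 ltW.
move=> /cdh_measure_basis ->; apply: eq_bigr => j _.
by rewrite cdhA_quadratic /=; ring: (sqr_sqrtr Nx0).
Qed.

Lemma cdhA_shift {R : realType} (a b : R[i]) (c s t : R) :
  cdhA (c - t) (a + t%:C) (b + t%:C) = cdhA (c - s) (a + s%:C) (b + s%:C).
Proof.
apply/funext => n; rewrite !cdhA_quadratic.
by case: a b => [a a'] [b b'] /=; ring.
Qed.

Theorem proposition3p8 (R : realType) (a b : R[i]) (c : R)
    (habc : cdh_params a b c)
    (s t x : R) (hst : s < t) (hx : cdhE c s x)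
    (p_st_x : probability (measurableTypeR R) R)
    (hp : is_cdh_kernel c s t x p_st_x)
    (n : nat) :
  (\int[p_st_x]_y ((cdh_at a b c n t).[y])%:E = ((cdh_at a b c n s).[x])%:E)%E.
Proof.
have moments : forall k : nat,
    p_st_x.-integrable setT (fun y : R => (y ^+ k)%:E).
  by move: hp; rewrite /is_cdh_kernel; case: ifP => _ [].
rewrite integral_horner//; congr EFin.
rewrite -[LHS]/(Rintegral_horner p_st_x moments _) /cdh_at !cdh_expansion.
rewrite linear_sum horner_sum.
apply: eq_bigr => k _; rewrite linearZ hornerZ (cdhA_shift _ _ _ s t)/=.
by congr (_ * _); exact: (cdh_kernel_basis _ _ _ _ _ hp).
Qed.
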